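(* Let $\beta\in(1,2)$. Suppose that \[ 0<\int_{I_\beta}\underline f(x)\,dx<\infty . \] Then the Bernoulli convolution $\nu_\beta$ is absolutely continuous (with respect to Lebesgue measure) with density function given for Lebesgue almost every $x\in I_\beta$ by \[ h_\beta(x)=\frac{\underline f(x)}{\int_{I_\beta}\underline f(y)\,dy}. \] Conversely, if $\nu_\beta$ is absolutely continuous with bounded density function $h_\beta$, then \[ 0<\int_{I_\beta}\underline f(x)\,dx<\infty . \]
   Context: For $\beta\in(1,2)$ let $I_\beta:=\left[0,\frac{1}{\beta-1}\right]$. A $\beta$-expansion of $x\in I_\beta$ is a sequence $(x_i)_{i\ge1}\in\{0,1\}^{\mathbb N}$ with $x=\sum_{i=1}^\infty x_i\beta^{-i}$. For $n\in\mathbb N$ put \[ \mathcal E^n_\beta(x):=\Big\{(x_1,\dots,x_n)\in\{0,1\}^n : \exists (x_{n+1},x_{n+2},\dots)\in\{0,1\}^{\mathbb N}\text{ with } x=\sum_{k=1}^\infty x_k\beta^{-k}\Big\}, \] and $\mathcal N_n(x;\beta):=|\mathcal E^n_\beta(x)|$. Define $f_n:I_\beta\to\mathbb R$ by \[ f_n(x):=\frac{(\beta-1)\beta^n}{2^n}\,\mathcal N_n(x;\beta), \] and $\underline f(x):=\liminf_{n\to\infty}f_n(x)\in[0,\infty]$. The Bernoulli convolution $\nu_\beta$ is the probability measure defined as the weak-star limit as $n\to\infty$ of the measures \[ \nu_{\beta,n}:=\frac1{2^n}\sum_{(a_1,\dots,a_n)\in\{0,1\}^n}\delta_{\sum_{i=1}^n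 a_i\beta^{-i}}, \] where $\delta_x$ is the Dirac measure at $x$. *)

(* Defs.v *)
From HB Require Import structures.
From mathcomp Require Import all_boot all_order all_algebra.
From mathcomp Require Import all_classical all_reals all_analysis.

Set Implicit Arguments.
Unset Strict Implicit.
Unset Printing Implicit Defensive.

Import Order.TTheory GRing.Theory Num.Theory.
Import numFieldNormedType.Exports.

Local Open Scope classical_set_scope.
Local Open Scope ring_scope.

Section BetaExpansions.
Context {R : realType}.
Implicit Types (beta x : R) (n : nat).

Definition I_ beta : set R := `[0, (beta - 1)^-1].

(* Digits are indexed from 0: [a i] is the digit x_(i+1). *)
Definition is_expansion beta (a : nat -> bool) x : Prop :=
  series (fun i => (a i)%:R * beta ^- i.+1) n @[n --> \oo] --> x.

Definition prefixes n beta x : {set n.-tuple bool} :=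
  finset (fun w : n.-tuple bool =>
    `[< exists a : nat -> bool,
          (forall i : 'I_n, a i = tnth w i) /\ is_expansion beta a x >]).

Definition count_prefixes n beta x : nat := #|prefixes n beta x|.

Definition f_ n beta x : R :=
  (beta - 1) * beta ^+ n / 2 ^+ n * (count_prefixes n beta x)%:R.

Definition f_inf beta x : \bar R := limn_einf (fun n => (f_ n beta x)%:E).

Definition int_f_inf beta : \bar R :=
  (\int[lebesgue_measure]_(x in I_ beta) f_inf beta x)%E.

End BetaExpansions.

Section BernoulliConvolution.
Context {R : realType}.
Implicit Types (beta : R) (n : nat).

Definition word_point n beta (w : n.-tuple bool) : R :=
  \sum_(i < n) (tnth w i)%:R * beta ^- i.+1.

Definition nu_approx n beta (A : set (measurableTypeR R)) : \bar R :=
  ((2 ^- n)%:E * \sum_(w : n.-tuple bool) \d_(word_point beta w) A)%E.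

Section nu_approx_measure.
Variables (n : nat) (beta : R).

Let nu_approx0 : nu_approx n beta set0 = 0%E.
Proof. by rewrite /nu_approx big1 ?mule0// => w _; rewrite measure0. Qed.

Let nu_approx_ge0 A : (0 <= nu_approx n beta A)%E.
Proof.
apply: mule_ge0; first by rewrite lee_fin invr_ge0 exprn_ge0.
by apply: sume_ge0 => w _; rewrite diracE lee_fin.
Qed.

Let nu_approx_sigma_additive : semi_sigma_additive (nu_approx n beta).
Proof.
move=> F mF tF mUF; rewrite /nu_approx.
rewrite [X in X @ _ --> _](_ : _ = fun k => ((2 ^- n)%:E *
    \sum_(w : n.-tuple bool)
      \sum_(0 <= i < k) \d_(word_point beta w) (F i))%E); last first.
  apply/funext => k; rewrite exchange_big/= ge0_sume_distrr// => i _.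
  by apply: sume_ge0 => w _; rewrite diracE lee_fin.
apply: cvgeZl => //; apply: cvg_nnesum => [w _|w _].
  by near=> k; apply: sume_ge0 => *; rewrite diracE lee_fin.
exact: measure_semi_sigma_additive.
Unshelve. all: by end_near. Qed.

HB.instance Definition _ := isMeasure.Build _ _ _ (nu_approx n beta)
  nu_approx0 nu_approx_ge0 nu_approx_sigma_additive.

Let nu_approx_setT : nu_approx n beta setT = 1%E.
Proof.
rewrite /nu_approx; under eq_bigr do rewrite diracT.
rewrite sumEFin sumr_const card_tuple card_bool -EFinM natrX.
by rewrite mulVf// expf_neq0// pnatr_eq0.
Qed.

HB.instance Definition _ :=
  Measure_isProbability.Build _ _ _ (nu_approx n beta) nu_approx_setT.

End nu_approx_measure.

(* All measures involved live on the compact interval [I_ beta], so testing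
   against bounded continuous functions on R is the same as weak-star
   convergence in the dual of C(I_ beta). *)
Definition weak_star_cvg (mu_ : nat -> probability (measurableTypeR R) R)
    (mu : probability (measurableTypeR R) R) : Prop :=
  forall g : R -> R, continuous g -> bounded_fun g ->
    (\int[mu_ n]_x (g x)%:E)%E @[n --> \oo] --> (\int[mu]_x (g x)%:E)%E.

(* Weak-star limits are unique, so this determines [nu]. *)
Definition is_bernoulli_convolution beta
    (nu : probability (measurableTypeR R) R) : Prop :=
  weak_star_cvg (fun n => nu_approx n beta) nu.

Definition is_density (nu : set (measurableTypeR R) -> \bar R) (h : R -> R) :
    Prop :=
  [/\ measurable_fun setT h, (forall x, 0 <= h x) &
      forall A : set (measurableTypeR R), measurable A ->
        nu A = (\int[lebesgue_measure]_(x in A) (h x)%:E)%E].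

End BernoulliConvolution.

(* Main.v *)
Require Import Defs.
From HB Require Import structures.
From mathcomp Require Import all_boot all_order all_algebra.
From mathcomp Require Import all_classical all_reals all_analysis.
From mathcomp Require Import measurable_realfun ring lra.
Import Order.TTheory GRing.Theory Num.Theory.
Import numFieldNormedType.Exports.
Local Open Scope classical_set_scope.
Local Open Scope ring_scope.


Set Implicit Arguments.
Unset Strict Implicit.
Unset Printing Implicit Defensive.

(** Write S_b y = (y + b) / beta for the two contractions (b = 0, 1) and
    T_b x = beta x - b for their inverses.  An expansion of x with first digit b
    is the digit b followed by an expansion of T_b x, hence
      f_(n+1) (x) = (beta / 2) (f_n (T_0 x) + f_n (T_1 x)),
    that is, f_(n+1) = transfer f_n, and f_0 = (beta - 1) 1_I because every point
    of I has an expansion.  On densities, transfer describes the measure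
    operator P |-> (S_0 P + S_1 P) / 2 whose fixed probability on I is the
    Bernoulli convolution nu (integral_transfer); in particular it preserves
    total mass, so every f_n has integral 1 and Fatou's lemma bounds the
    integral J of the liminf f by 1.

    Suppose J > 0.  The liminf is superadditive, so transfer f <= f pointwise;
    as both sides have the same finite integral J, they have the same integral
    over every measurable set (integral_f_inf_branch).  Thus f / J is the density
    of a probability on I fixed by the operator above.  Such a probability is
    unique: tested on an L-Lipschitz function, two of them differ by at most
    2 L |I|, and self-similarity replaces L by L / beta as often as one likes
    (self_similar_unique).  Hence nu has density f / J.

    Conversely let nu have a density h <= C.  As nu is carried by I,
    nu <= C 1_I dx = C / (beta - 1) f_0 dx, and applying the operator n times
    turns this into nu <= C / (beta - 1) f_n dx
    (bernoulli_le_integral_f).  So h <= C / (beta - 1) f_n almost everywhere for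
    all n at once, thus for the liminf too, and integration gives
    J >= (beta - 1) / C > 0. *)

(** * Digit recursion for the number of prefixes *)

Definition expand {R : realType} (beta : R) (b : bool) (x : R) : R :=
  beta * x - b%:R.

Definition contract {R : realType} (beta : R) (b : bool) (y : R) : R :=
  (y + b%:R) / beta.

Lemma contractK {R : realType} (beta : R) (b : bool) : beta != 0 ->
  cancel (contract beta b) (expand beta b).
Proof. by move=> b0 y; rewrite /contract /expand; field. Qed.

Lemma expandK {R : realType} (beta : R) (b : bool) : beta != 0 ->
  cancel (expand beta b) (contract beta b).
Proof. by move=> b0 y; rewrite /contract /expand; field. Qed.

(** Peeling off the first digit: this is what makes the counting functions
    satisfy a recursion. *)
Lemma is_expansion_shift {R : realType} (beta : R) (a : nat -> bool) (x : R) :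
  beta != 0 ->
  is_expansion beta a x <->
  is_expansion beta (fun i => a i.+1) (expand beta (a 0%N) x).
Proof.
move=> b0; rewrite /is_expansion.
set s := series _; set t := series _.
have st n : s n.+1 = contract beta (a 0%N) (t n).
  rewrite /s /t /series /= big_nat_recl//= /contract mulrDl addrC; congr (_ + _).
  rewrite mulr_suml; apply: eq_bigr => i _.
  by rewrite (exprSr _ i.+1) invfM mulrA.
split.
- rewrite -cvg_shiftS => h.
  have -> : t = (fun n => beta * s n.+1 - (a 0%N)%:R).
    by apply/funext => n; rewrite st -/(expand beta (a 0%N) _) contractK.
  by apply: cvgB; [apply: cvgMr; exact: h|exact: cvg_cst].
- move=> h; rewrite -cvg_shiftS.
  under eq_fun do rewrite st.
  rewrite -(expandK (a 0%N) b0 x).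
  by apply: cvgMl; apply: cvgD; [exact: h|exact: cvg_cst].
Qed.

Lemma count_prefixesS {R : realType} (n : nat) (beta x : R) : beta != 0 ->
  count_prefixes n.+1 beta x =
  (count_prefixes n beta (expand beta false x) +
   count_prefixes n beta (expand beta true x))%N.
Proof.
move=> b0; rewrite /count_prefixes.
pose cns (b : bool) (w : n.-tuple bool) : n.+1.-tuple bool := [tuple of b :: w].
have cnsI b : injective (cns b).
  by move=> v w /(congr1 val) [] /val_inj.
have cnsP b w : (cns b w \in prefixes n.+1 beta x) =
                (w \in prefixes n beta (expand beta b x)).
  rewrite !inE; apply/asboolP/asboolP => -[a [aw ax]].
  - have a0 : a 0%N = b by rewrite [LHS](aw ord0).
    exists (fun i => a i.+1); split; last first.
      by have /(is_expansion_shift a x b0) := ax; rewrite a0.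
    move=> i; have := aw (lift ord0 i); rewrite !(tnth_nth false) /= => <-.
    by rewrite /bump leq0n.
  - exists (fun i => if i is j.+1 then a j else b); split; last first.
      exact/(is_expansion_shift _ x b0).
    move=> [[|i] iP]; rewrite (tnth_nth false)//=.
    by rewrite (aw (Ordinal (iP : (i < n)%N))) (tnth_nth false).
rewrite -(card_imset _ (cnsI false)) -(card_imset _ (cnsI true)) -cardsUI.
rewrite [X in (_ + #|pred_of_set X|)%N](_ : _ = finset.set0); last first.
  apply/setP => w; rewrite !inE; apply/negP => /andP[/imsetP[v _ ->] /imsetP[u _]].
  by move=> /(congr1 val).
rewrite cards0 addn0; apply: eq_card => w; rewrite !inE.
case/tupleP: w => b w.
have -> : [tuple of b :: w] = cns b w by apply/val_inj.
have := cnsP b w; rewrite inE => ->.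
apply/idP/orP => [wP|].
  by case: b wP => wP; [right|left]; apply/imsetP; exists w.
by case=> /imsetP[v vP] /(congr1 val)[-> /val_inj ->].
Qed.

Lemma f_S {R : realType} (n : nat) (beta x : R) : beta != 0 ->
  f_ n.+1 beta x =
  beta / 2 * (f_ n beta (expand beta false x) + f_ n beta (expand beta true x)).
Proof.
move=> b0; rewrite /f_ count_prefixesS// natrD -mulrDr !exprS invfM.
ring.
Qed.

(** I is covered by its two images under the contractions, because beta <= 2;
    this lets the digits of an expansion be chosen one after the other. *)
Lemma expand_stays_I {R : realType} (beta x : R) : 1 < beta < 2 -> I_ beta x ->
  exists b, I_ beta (expand beta b x).
Proof.
move=> /andP[b1 b2]; rewrite /I_ /= in_itv /= => /andP[x0 xM].
have Mb : beta * (beta - 1)^-1 - 1 = (beta - 1)^-1.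
  by field; rewrite subr_eq0 gt_eqF.
have M1 : 1 <= (beta - 1)^-1 by rewrite invf_ge1; lra.
have bx : beta * x <= beta * (beta - 1)^-1 by rewrite ler_pM2l//; lra.
have [xs|xl] := leP 1 (beta * x).
- by exists true; rewrite /expand /= in_itv /=; apply/andP; split; lra.
- exists false; rewrite /expand /= in_itv /= subr0; apply/andP; split; last by lra.
  by rewrite mulr_ge0//; lra.
Qed.

(** Iterating an expanding map that keeps the point in I leaves, after n digits,
    a remainder beta^-n y with y in the bounded interval I. *)
Lemma expansion_exists {R : realType} (beta x : R) : 1 < beta < 2 -> I_ beta x ->
  exists a, is_expansion beta a x.
Proof.
move=> b12 Ix; have /andP[b1 b2] := b12.
(* the digit 1 is chosen whenever it is admissible *)
pose d y := `[< I_ beta (expand beta true y) >].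
pose T y := expand beta (d y) y.
have dI y : I_ beta y -> I_ beta (T y).
  move=> /(expand_stays_I b12)[b bI]; rewrite /T; case: (boolP (d y)) => [/asboolP//|].
  by move=> /asboolPn nI; case: b bI.
have TI n : I_ beta (iter n T x) by elim: n => //= n; exact: dI.
exists (fun i => d (iter i T x)); rewrite /is_expansion.
set s := series _.
have sE n : s n = x - beta ^- n * iter n T x.
  elim: n => [|n IH]; first by rewrite /s /series /= big_geq// expr0 invr1 mul1r subrr.
  rewrite /s seriesSr -/s IH /= exprS invfM; set y := iter n T x.
  rewrite /T /expand; set p := beta ^- n.
  by field; lra.
have : beta ^- n * iter n T x @[n --> \oo] --> 0.
  have h : geometric (beta - 1)^-1 (beta^-1) @ \oo --> 0.
    by apply: cvg_geometric; rewrite gtr0_norm ?invf_lt1 ?invr_gt0//; lra.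
  apply: (@squeeze_cvgr _ _ _ _ (cst 0) (geometric (beta - 1)^-1 (beta^-1)) _) => //;
    last exact: cvg_cst.
  apply: nearW => n; have := TI n; rewrite /I_ /= in_itv /= => /andP[t0 tM].
  have bn : 0 <= beta ^- n by rewrite invr_ge0 exprn_ge0//; lra.
  by rewrite mulr_ge0//= exprVn mulrC ler_wpM2r.
move=> h; have -> : s = (fun n => x - beta ^- n * iter n T x) by apply/funext.
have := cvgB (cvg_cst x) h; rewrite subr0; exact.
Qed.

(** By induction on n from the left, since S_0 and S_1 map I into itself. *)
Lemma digit_sum_I {R : realType} (beta : R) (a : nat -> bool) n : 1 < beta ->
  0 <= \sum_(i < n) (a i)%:R * beta ^- i.+1 <= (beta - 1)^-1.
Proof.
move=> b1; apply/andP; split.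
  by apply: sumr_ge0 => i _; rewrite mulr_ge0// invr_ge0 exprn_ge0//; lra.
elim: n a => [|n IH] a; first by rewrite big_ord0 invr_ge0; lra.
rewrite big_ord_recl/= expr1.
under eq_bigr do rewrite /bump/= add1n exprSr invfM mulrA.
rewrite -mulr_suml -mulrDl.
have := IH (fun i => a i.+1).
set y := (\sum_(_ < _) _); set M := _^-1 => yM.
have Mb : (1 + M) = M * beta by rewrite /M; field; lra.
rewrite ler_pdivrMr; last by lra.
by rewrite -Mb lerD//; case: (a _).
Qed.

Lemma is_expansion_I {R : realType} (beta x : R) a : 1 < beta ->
  is_expansion beta a x -> I_ beta x.
Proof.
move=> b1 ax; rewrite /I_.
have cl : closed (`[0, (beta - 1)^-1] : set R) by exact: interval_closed.
apply: (closed_cvg _ cl _ _ ax); apply: nearW => n /=.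
by rewrite in_itv/= /series/= big_mkord; exact: digit_sum_I.
Qed.

Lemma f_0 {R : realType} (beta x : R) : 1 < beta < 2 ->
  f_ 0 beta x = (beta - 1) * \1_(I_ beta) x.
Proof.
move=> b12; rewrite /f_ !expr0 mulr1 divr1; congr (_ * _).
rewrite indicE /count_prefixes; have [xI|xI] := pselect (I_ beta x).
- rewrite mem_set//; have [a ax] := expansion_exists b12 xI.
  rewrite (_ : prefixes 0 beta x = finset.setT) ?cardsT ?card_tuple//.
  apply/setP => w; rewrite !inE; apply/asboolP; exists a; split => //.
  by case.
- rewrite memNset//; congr (_ %:R); apply/eqP; rewrite cards_eq0; apply/eqP/setP => w.
  rewrite !inE; apply/asboolP => -[a [_ ax]]; apply: xI.
  by case/andP: b12 => b1 _; exact: is_expansion_I ax.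
Qed.

Lemma f_eq0_out {R : realType} n (beta x : R) : 1 < beta -> ~ I_ beta x ->
  f_ n beta x = 0.
Proof.
move=> b1 xI; rewrite /f_ [count_prefixes _ _ _](_ : _ = 0%N) ?mulr0//.
apply/eqP; rewrite cards_eq0; apply/eqP/setP => w.
rewrite !inE; apply/asboolP => -[a [_ ax]]; apply: xI.
exact: is_expansion_I ax.
Qed.

Lemma f_ge0 {R : realType} n (beta x : R) : 1 < beta -> 0 <= f_ n beta x.
Proof.
by move=> b1; rewrite /f_ !mulr_ge0// ?invr_ge0 ?exprn_ge0 //; lra.
Qed.

(** * Measures and integrals under the two contractions *)

Lemma continuous_contract {R : realType} (beta : R) b :
  continuous (contract beta b).
Proof.
move=> x; apply: cvgMl; apply: cvgD; [exact: cvg_id|exact: cvg_cst].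
Qed.

Lemma continuous_expand {R : realType} (beta : R) b :
  continuous (expand beta b).
Proof.
move=> x; apply: cvgB; last exact: cvg_cst.
by apply: cvgMr; exact: cvg_id.
Qed.

Lemma measurable_contract {R : realType} (beta : R) b :
  measurable_fun setT (contract beta b : measurableTypeR R -> measurableTypeR R).
Proof.
exact: continuous_measurable_fun (@continuous_contract _ _ _).
Qed.

Lemma measurable_expand {R : realType} (beta : R) b :
  measurable_fun setT (expand beta b : measurableTypeR R -> measurableTypeR R).
Proof.
exact: continuous_measurable_fun (@continuous_expand _ _ _).
Qed.

Definition contract_mfun {R : realType} (beta : R) b :
    {mfun measurableTypeR R >-> measurableTypeR R} :=
  HB.pack (contract beta b : measurableTypeR R -> measurableTypeR R)
    (isMeasurableFun.Build _ _ _ _ _ (measurable_contract beta b)).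

(** The operator of the iterated function system on probabilities, whose fixed
    point is the Bernoulli convolution. *)
Definition branch_avg {R : realType} (beta : R)
    (P : probability (measurableTypeR R) R) :=
  mscale (2^-1)%:nng (measure_add (distribution P (contract_mfun beta false))
                                  (distribution P (contract_mfun beta true))).

HB.instance Definition _ {R : realType} (beta : R)
    (P : probability (measurableTypeR R) R) :=
  Measure.on (branch_avg beta P).

Lemma branch_avgE {R : realType} (beta : R)
    (P : probability (measurableTypeR R) R) A :
  branch_avg beta P A =
  ((2^-1)%:E * (P (contract beta false @^-1` A) +
                P (contract beta true @^-1` A)))%E.
Proof. by congr (_ * _)%E; exact: measure_addE. Qed.

Lemma integral_branch_avg {R : realType} (beta : R)
    (P : probability (measurableTypeR R) R) (u : R -> \bar R) :
  measurable_fun setT u -> (forall x, 0 <= u x)%E ->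
  (\int[branch_avg beta P]_x u x =
   (2^-1)%:E * (\int[P]_x u (contract beta false x) +
                \int[P]_x u (contract beta true x)))%E.
Proof.
move=> mu u0; rewrite ge0_integral_mscale// ge0_integral_measure_add//.
by rewrite !ge0_integral_distribution.
Qed.

(** Affine change of variables for an arbitrary nonnegative measurable integrand:
    beta times Lebesgue measure is pushed by the expanding map to Lebesgue measure. *)
Lemma lebesgue_expand {R : realType} (beta : R) b (u : R -> \bar R)
    (A : set (measurableTypeR R)) :
  0 < beta -> measurable A ->
  measurable_fun setT u -> (forall x, 0 <= u x)%E ->
  (beta%:E * \int[lebesgue_measure]_(x in A) u (expand beta b x) =
   \int[lebesgue_measure]_(y in contract beta b @^-1` A) u y)%E.
Proof.
move=> b0 mA mu u0.
pose k : {nonneg R} := NngNum (ltW b0).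
have mcA : measurable (contract beta b @^-1` A).
  rewrite -[_ @^-1` _]setTI.
  exact: measurable_contract.
have mexp := measurable_expand beta b.
pose m := pushforward (mscale k (@lebesgue_measure R))
  (expand beta b : measurableTypeR R -> measurableTypeR R).
have mE B : measurable B -> m B = lebesgue_measure B.
  move=> mB; apply/esym/lebesgue_measure_unique => // _ [[p q] _ <-].
  have pre : expand beta b @^-1` `]p, q]%classic =
      `]contract beta b p, contract beta b q]%classic.
    apply/seteqP; split => x /=; rewrite !in_itv/= /expand /contract.
      by rewrite ltr_pdivrMr// ler_pdivlMr// ltrBrDr lerBlDr mulrC.
    by rewrite ltr_pdivrMr// ler_pdivlMr// ltrBrDr lerBlDr mulrC.
  rewrite -[RHS]/(beta%:E *
    lebesgue_measure (expand beta b @^-1` `]p, q]%classic))%E pre.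
  rewrite !lebesgue_measure_itv/= !lte_fin /contract ltr_pM2r ?invr_gt0// ltrD2r.
  case: ifPn => _; last by rewrite mule0.
  by rewrite -!EFinB -EFinM; congr EFin; field; lra.
rewrite -[RHS](@eq_measure_integral _ _ _ _ _ m); last by move=> B mB _; exact: mE.
rewrite /m ge0_integral_pushforward//; last exact: measurable_funTS.
have preA : expand beta b @^-1` (contract beta b @^-1` A) = A.
  by apply/seteqP; split => x; rewrite /preimage/= (expandK b (lt0r_neq0 b0)).
rewrite preA ge0_integral_mscale//.
  by apply: measurable_funTS; exact: measurableT_comp.
by move=> x _; exact: u0.
Qed.

(** * The counting functions and their lower limit *)

(** The action of [branch_avg] on Lebesgue densities. *)
Definition transfer {R : realType} (beta : R) (u : R -> \bar R) (x : R) : \bar R :=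
  ((beta / 2)%:E * (u (expand beta false x) + u (expand beta true x)))%E.

Lemma measurable_transfer {R : realType} (beta : R) (u : R -> \bar R) :
  measurable_fun setT u -> measurable_fun setT (transfer beta u).
Proof.
move=> mu; apply: measurable_funeM; apply: emeasurable_funD;
  exact: (measurableT_comp mu (measurable_expand _ _)).
Qed.

Lemma integral_transfer {R : realType} (beta : R) (u : R -> \bar R)
    (A : set (measurableTypeR R)) :
  0 < beta -> measurable A ->
  measurable_fun setT u -> (forall x, 0 <= u x)%E ->
  (\int[lebesgue_measure]_(x in A) transfer beta u x =
   (2^-1)%:E *
     (\int[lebesgue_measure]_(y in contract beta false @^-1` A) u y +
      \int[lebesgue_measure]_(y in contract beta true @^-1` A) u y))%E.
Proof.
move=> b0 mA mu u0.
have mub b : measurable_fun A (fun x => u (expand beta b x)).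
  by apply: measurable_funTS; exact: (measurableT_comp mu (measurable_expand _ _)).
rewrite ge0_integralZl//; last 3 first.
- exact: emeasurable_funD.
- by move=> x _; exact: adde_ge0.
- by rewrite lee_fin; lra.
rewrite ge0_integralD// mulrC EFinM -muleA; congr (_ * _)%E.
by rewrite ge0_muleDr ?integral_ge0// !lebesgue_expand.
Qed.

Lemma base_gt1_gt0 {R : realType} (beta : R) : 1 < beta < 2 -> 1 < beta /\ 0 < beta.
Proof. by case/andP => b1 _; split => //; exact: lt_trans b1. Qed.

Section f_inf.
Context {R : realType} (beta : R) (b12 : 1 < beta < 2).

Lemma measurable_I : measurable (I_ beta : set (measurableTypeR R)).
Proof. exact: measurable_itv. Qed.

Lemma lebesgue_I : lebesgue_measure (I_ beta) = ((beta - 1)^-1)%:E.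
Proof.
have [b1 b0] := base_gt1_gt0 b12.
by rewrite /I_ lebesgue_measure_itv/= lte_fin invr_gt0 subr_gt0 b1 sube0.
Qed.

Lemma f_transfer n x :
  (f_ n.+1 beta x)%:E = transfer beta (fun y => (f_ n beta y)%:E) x.
Proof.
have [b1 b0] := base_gt1_gt0 b12.
by rewrite /transfer -EFinD -EFinM f_S// lt0r_neq0. Qed.

Lemma measurable_f n : measurable_fun setT (fun x : R => (f_ n beta x)%:E).
Proof.
have [b1 b0] := base_gt1_gt0 b12.
elim: n => [|n IH].
- under eq_fun do rewrite f_0//; apply/measurable_EFinP.
  apply: measurable_funM => //; apply: measurable_indic; exact: measurable_I.
- by under eq_fun do rewrite f_transfer//; exact: measurable_transfer.
Qed.

Lemma integral_f n :
  (\int[lebesgue_measure]_x (f_ n beta x)%:E = 1)%E.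
Proof.
have [b1 b0] := base_gt1_gt0 b12.
elim: n => [|n IH].
- under eq_integral do rewrite f_0// EFinM.
  rewrite ge0_integralZl//; last 2 first.
  + by apply/measurable_EFinP/measurable_indic; exact: measurable_I.
  + by rewrite lee_fin; lra.
  rewrite integral_indic//; last exact: measurable_I.
  rewrite setIT (_ : _ (I_ beta) = ((beta - 1)^-1)%:E); last exact: lebesgue_I.
  by rewrite -EFinM divff//; lra.
- under eq_integral do rewrite f_transfer.
  rewrite integral_transfer//; last 2 first.
  + exact: measurable_f.
  + by move=> x; rewrite lee_fin f_ge0.
  by rewrite !preimage_setT IH -EFinD -EFinM; congr EFin; lra.
Qed.

Lemma f_inf_ge0 x : (0 <= f_inf beta x)%E.
Proof.
have [b1 b0] := base_gt1_gt0 b12.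
rewrite /f_inf limn_einf_lim; apply: lime_ge; first exact: is_cvg_einfs.
apply: nearW => n; apply: le_ereal_inf_tmp => _ [m _ <-].
by rewrite lee_fin f_ge0.
Qed.

Lemma measurable_f_inf : measurable_fun setT (f_inf beta).
Proof.
have [b1 b0] := base_gt1_gt0 b12.
apply: measurableT_comp => //.
apply: measurable_fun_limn_esup => n.
apply: measurableT_comp => //; exact: measurable_f.
Qed.

Lemma f_inf_eq0_out x : ~ I_ beta x -> f_inf beta x = 0%E.
Proof.
have [b1 b0] := base_gt1_gt0 b12.
move=> xI; rewrite /f_inf; under eq_fun do rewrite f_eq0_out//.
by have [-> _] := cvg_limn_einf_sup (cvg_cst (0%E : \bar R)).
Qed.

(** The integral over I is one over the line, where changes of variables need
    no bookkeeping of the domain. *)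
Lemma int_f_infE :
  int_f_inf beta = (\int[lebesgue_measure]_x f_inf beta x)%E.
Proof.
have [b1 b0] := base_gt1_gt0 b12.
rewrite /int_f_inf integral_mkcond; apply: eq_integral => x _.
rewrite patchE; case: ifPn => //; rewrite notin_setE => xI.
by rewrite f_inf_eq0_out.
Qed.

(** Fatou's lemma, since all the functions f_n have integral 1. *)
Lemma int_f_inf_le1 : (int_f_inf beta <= 1)%E.
Proof.
have [b1 b0] := base_gt1_gt0 b12.
rewrite int_f_infE.
apply: (le_trans (fatou lebesgue_measure measurableT _ _)).
- by move=> n; exact: measurable_f.
- by move=> n x _; rewrite lee_fin f_ge0.
- under eq_fun do rewrite integral_f.
  by have [-> _] := cvg_limn_einf_sup (cvg_cst (1%E : \bar R)).
Qed.

(** Superadditivity of the liminf: an infimum over a tail of sums is at least the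
    sum of the two infima. *)
Lemma transfer_f_inf_le x : (transfer beta (f_inf beta) x <= f_inf beta x)%E.
Proof.
have [b1 b0] := base_gt1_gt0 b12.
rewrite /transfer.
pose e x n := einfs (fun n => (f_ n beta x)%:E) n.
have e0 y n : (0 <= e y n)%E.
  by apply: le_ereal_inf_tmp => _ [m _ <-]; rewrite lee_fin f_ge0.
have ecvg y : e y @ \oo --> f_inf beta y.
  by rewrite /f_inf limn_einf_lim; exact: is_cvg_einfs.
have lcvg : (fun n => (beta / 2)%:E *
   (e (expand beta false x) n + e (expand beta true x) n))%E @ \oo -->
   ((beta / 2)%:E * (f_inf beta (expand beta false x) +
                     f_inf beta (expand beta true x)))%E.
  apply: cvgeZl => //; apply: cvgeD => //.
  by apply: ge0_adde_def; rewrite inE f_inf_ge0.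
have rcvg : e x n.+1 @[n --> \oo] --> f_inf beta x by rewrite cvg_shiftS.
rewrite -(cvg_lim _ lcvg)// -(cvg_lim _ rcvg)//.
apply: lee_lim; [by apply/cvg_ex; eexists; exact: lcvg|
                 by apply/cvg_ex; eexists; exact: rcvg|].
apply: nearW => n; apply: le_ereal_inf_tmp => _ [[|m] //= nm <-].
rewrite f_transfer /transfer lee_pmul2l//; last by rewrite lte_fin; lra.
by apply: leeD; apply: ereal_inf_lbound; exists m.
Qed.

(** A function below another one with the same finite total integral has the
    same integral over every set: a strict inequality on A could not be
    compensated on the complement of A. *)
Lemma integral_f_inf_branch (A : set (measurableTypeR R)) : measurable A ->
  (\int[lebesgue_measure]_(x in A) f_inf beta x = (2^-1)%:E *
     (\int[lebesgue_measure]_(y in contract beta false @^-1` A) f_inf beta y +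
      \int[lebesgue_measure]_(y in contract beta true @^-1` A) f_inf beta y))%E.
Proof.
have [b1 b0] := base_gt1_gt0 b12.
move=> mA.
have mf := measurable_f_inf; have f0 := f_inf_ge0.
have mt := measurable_transfer beta mf.
have t0 x : (0 <= transfer beta (f_inf beta) x)%E.
  by rewrite mule_ge0// ?adde_ge0// lee_fin; lra.
rewrite -integral_transfer//.
have le B : measurable B -> 
  (\int[lebesgue_measure]_(x in B) transfer beta (f_inf beta) x <=
   \int[lebesgue_measure]_(x in B) f_inf beta x)%E.
  move=> mB; apply: ge0_le_integral => //.
  - exact: measurable_funTS.
  - exact: measurable_funTS.
  - by move=> x _; exact: transfer_f_inf_le.
have J1 : (\int[lebesgue_measure]_x f_inf beta x <= 1)%E.
  by rewrite -int_f_infE int_f_inf_le1.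
have tot : (\int[lebesgue_measure]_x transfer beta (f_inf beta) x =
            \int[lebesgue_measure]_x f_inf beta x)%E.
  rewrite integral_transfer// !preimage_setT.
  have : (\int[lebesgue_measure]_x f_inf beta x)%E \is a fin_num.
    rewrite ge0_fin_numE; first by rewrite (le_lt_trans J1)// ltry.
    exact: integral_ge0.
  move=> /fineK <-; rewrite -EFinD -EFinM; congr EFin; lra.
have spl (u : R -> \bar R) : measurable_fun setT u -> (forall x, 0 <= u x)%E ->
  (\int[lebesgue_measure]_x u x = \int[lebesgue_measure]_(x in A) u x +
    \int[lebesgue_measure]_(x in ~` A) u x)%E.
  move=> mu u0; rewrite -ge0_integral_setU//; first by rewrite setUv.
  - exact: measurableC.
  - by rewrite setUv.
  - by apply/disj_setPS; rewrite setICr.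
apply/eqP; rewrite eq_le le// andbT leNgt; apply/negP => lt.
move: tot; rewrite (spl _ mt t0) (spl _ mf f0) => tot.
have := le _ (measurableC mA); rewrite leNgt => /negP; apply.
have Cfin : (\int[lebesgue_measure]_(x in ~` A) f_inf beta x)%E \is a fin_num.
  rewrite ge0_fin_numE; last exact: integral_ge0.
  apply: le_lt_trans (ltry 1); apply: le_trans J1.
  by apply: ge0_subset_integral => //; exact: measurableC.
have : (\int[lebesgue_measure]_(x in A) transfer beta (f_inf beta) x + 
  \int[lebesgue_measure]_(x in ~` A) f_inf beta x <
  \int[lebesgue_measure]_(x in A) f_inf beta x + 
  \int[lebesgue_measure]_(x in ~` A) f_inf beta x)%E by rewrite lteD2rE.
rewrite -tot lteD2lE// ge0_fin_numE; last exact: integral_ge0.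
by rewrite (lt_le_trans lt)// leey.
Qed.

End f_inf.

(** * Lipschitz functions determine a finite Borel measure *)

(** Test functions are kept in [0, 1] so that nonnegative integration applies;
    the one-sided inequality gives the Lipschitz bound by exchanging x and y. *)
Definition lip_test {R : realType} (L : R) (g : R -> R) : Prop :=
  (forall x, 0 <= g x <= 1) /\ (forall x y, g x <= g y + L * `|x - y|).

Lemma lip_test_continuous {R : realType} (L : R) (g : R -> R) :
  lip_test L g -> continuous g.
Proof.
move=> [_ lg] x; apply/cvgrPdist_lt => e e0.
have K0 : 0 < `|L| + 1 by rewrite ltr_wpDl.
near=> y.
have xy : `|x - y| < e / (`|L| + 1).
  by near: y; apply: (@cvgr_dist_lt _ _ _ (nbhs x) _ id x) => //; rewrite divr_gt0.
have LK : L * `|x - y| <= (`|L| + 1) * `|x - y|.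
  by rewrite ler_wpM2r// ler_wpDr// ler_norm.
have := xy; rewrite ltr_pdivlMr// mulrC => xye.
have h1 := lg x y; have h2 := lg y x; rewrite distrC in h2.
by rewrite ltr_norml; apply/andP; split; lra.
Unshelve. all: by end_near. Qed.

Lemma lip_test_measurable {R : realType} (L : R) (g : R -> R) :
  lip_test L g -> measurable_fun setT (fun x : R => (g x)%:E).
Proof.
move=> /lip_test_continuous/continuous_measurable_fun.
by move/measurable_EFinP.
Qed.

Lemma lip_test_bounded {R : realType} (L : R) (g : R -> R) :
  lip_test L g -> bounded_fun g.
Proof.
move=> [g01 _]; exists 1; split => // r r1 x _ /=.
by have /andP[? ?] := g01 x; rewrite ger0_norm//; lra.
Qed.

(** The gain of a factor beta that forces uniqueness of self-similar
    probabilities. *)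
Lemma lip_test_contract {R : realType} (beta L : R) (g : R -> R) b :
  0 < beta -> lip_test L g -> lip_test (L / beta) (g \o contract beta b).
Proof.
move=> b0 [g01 lg]; split=> [x|x y] /=; first exact: g01.
apply: le_trans (lg _ (contract beta b y)) _; rewrite lerD2l /contract -mulrBl normrM.
rewrite (_ : x + _ - _ = x - y); last by lra.
by rewrite [`|beta^-1|]gtr0_norm ?invr_gt0// mulrA mulrAC.
Qed.

Lemma lip_test_min {R : realType} (L : R) (s : R -> R) : 0 <= L ->
  (forall x, 0 <= s x) -> (forall x y, s x <= s y + L * `|x - y|) ->
  lip_test L (fun x => Num.min 1 (s x)).
Proof.
move=> L0 s0 ls; split=> [x|x y].
  by rewrite ge_min lexx/= le_min ler01 s0.
have d0 : 0 <= L * `|x - y| by rewrite mulr_ge0.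
have sxy := ls x y.
by have [] := leP 1 (s x); have [] := leP 1 (s y); lra.
Qed.

(** The Lipschitz ramps min (1, k (a - x)^+) increase to the indicator of the ray
    ]-oo, a[, and these rays form a pi-system generating the Borel sets. *)
Lemma eq_measure_lip_test {R : realType}
    (m1 m2 : {measure set (measurableTypeR R) -> \bar R}) :
  (m1 setT < +oo)%E ->
  (forall L g, 0 <= L -> lip_test L g ->
     (\int[m1]_x (g x)%:E = \int[m2]_x (g x)%:E)%E) ->
  forall A, measurable A -> m1 A = m2 A.
Proof.
move=> m1oo m12.
pose s (a : R) (k : nat) (x : R) := k%:R * Num.max 0 (a - x).
pose g a k x : R := Num.min 1 (s a k x).
have s0 a k x : 0 <= s a k x by rewrite mulr_ge0// le_max lexx.
have gt a k : lip_test k%:R (g a k).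
  apply: lip_test_min => // x y; rewrite /s -mulrDr ler_wpM2l//.
  have := ler_norm (y - x); rewrite distrC => h.
  have := normr_ge0 (x - y).
  by have [] := leP 0 (a - x); have [] := leP 0 (a - y); lra.
have ray (m : {measure set (measurableTypeR R) -> \bar R}) a :
    m `]-oo, a[%classic = limn (fun k => \int[m]_x (g a k x)%:E)%E.
  rewrite -monotone_convergence//; last 3 first.
  - by move=> k; exact: lip_test_measurable (gt a k).
  - by move=> k x _; rewrite lee_fin; have [/(_ x)/andP[]] := gt a k.
  - move=> x _ i j ij; rewrite lee_fin le_min ge_min lexx/=.
    rewrite ge_min; apply/orP; right.
    by rewrite ler_wpM2r ?ler_nat// le_max lexx.
  transitivity (\int[m]_x (\1_(`]-oo, a[%classic : set R) x)%:E)%E.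
    by rewrite integral_indic ?setIT//; exact: measurable_itv.
  apply: eq_integral => x _; apply/esym/cvg_lim => //.
  rewrite indicE; have [xa|xa] := ltP x a.
  - rewrite mem_set/= ?in_itv//=.
    apply: cvg_near_cst.
    (* the ramp reaches 1 at x as soon as k >= 1 / (a - x) *)
    have [N _ Nle] : \forall k \near \oo, (a - x)^-1 <= k%:R :> R.
      by near=> k; near: k; exact: nbhs_infty_ger.
    exists N => // k /= /Nle h; congr EFin; apply/min_idPl.
    rewrite /s (max_idPr _); last by rewrite subr_ge0 ltW.
    by rewrite -ler_pdivrMr ?subr_gt0// mul1r.
  - rewrite memNset/= ?in_itv/= ?ltNge ?xa//.
    apply: cvg_near_cst; apply: nearW => k; congr EFin.
    rewrite /g /s (max_idPl _) ?subr_le0// mulr0.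
    by apply/min_idPr.
move=> A mA.
apply: (@measure_unique _ R (measurableTypeR R) (@RGenInftyO.G R)
  (fun k => `]-oo, k%:R[%classic) _ _ _ _ m1 m2 _ _ A mA).
- exact: RGenInftyO.measurableE.
- move=> _ _ [a ->] [b ->]; exists (Num.min a b).
  by apply/seteqP; split => x /=; rewrite !in_itv/= lt_min => /andP.
- by move=> k; exists k%:R.
- apply/seteqP; split => // x _.
  exists (Num.truncn `|x|).+1 => //=; rewrite in_itv/=.
  by rewrite (le_lt_trans (ler_norm _))// truncnS_gt.
- move=> _ [a ->]; rewrite !ray; congr (limn _); apply/funext => k.
  exact: m12 (gt a k).
- move=> k; apply: le_lt_trans m1oo; apply: le_measure; rewrite ?inE//.
Unshelve. all: by end_near. Qed.

(** * Uniqueness of the self-similar probability *)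

Lemma integral_cst_probability {R : realType}
    (P : probability (measurableTypeR R) R) (c : R) :
  (\int[P]_x (cst c%:E) x = c%:E)%E.
Proof.
rewrite integral_cst// [X in (_ * X)%E](_ : _ = 1%E) ?mule1//.
exact: probability_setT.
Qed.

Lemma integral_lip_test_fin {R : realType} (L : R) (g : R -> R)
    (P : probability (measurableTypeR R) R) :
  lip_test L g -> (\int[P]_x (g x)%:E)%E \is a fin_num.
Proof.
move=> gt; have [g01 _] := gt.
have g0 x : (0 <= (g x)%:E)%E by rewrite lee_fin; have /andP[] := g01 x.
rewrite ge0_fin_numE; last exact: integral_ge0.
apply: le_lt_trans (ltry 1).
apply: (@le_trans _ _ (\int[P]_x (cst 1%E x))%E).
  apply: ge0_le_integral => //; first exact: lip_test_measurable gt.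
  by move=> x _; rewrite lee_fin; have /andP[] := g01 x.
by rewrite integral_cst_probability.
Qed.

Definition self_similar {R : realType} (beta : R)
    (P : probability (measurableTypeR R) R) : Prop :=
  forall A, measurable A -> P A = branch_avg beta P A.

Lemma integral_lip_test_self_similar {R : realType} (beta L : R) (g : R -> R)
    (P : probability (measurableTypeR R) R) :
  self_similar beta P -> lip_test L g ->
  (\int[P]_x (g x)%:E =
   (2^-1)%:E * (\int[P]_x ((g \o contract beta false) x)%:E +
                \int[P]_x ((g \o contract beta true) x)%:E))%E.
Proof.
move=> ssP gt; have [g01 _] := gt.
rewrite (eq_measure_integral (branch_avg beta P)); last by move=> A mA _; exact: ssP.
rewrite integral_branch_avg//; first exact: lip_test_measurable gt.
by move=> x; rewrite lee_fin; have /andP[] := g01 x.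
Qed.

(** The base of the contraction argument: on I a test function stays within L |I|
    of its value at 0. *)
Lemma integral_lip_test_near0 {R : realType} (beta L : R) (g : R -> R)
    (P : probability (measurableTypeR R) R) :
  1 < beta < 2 -> P (~` I_ beta) = 0%E -> 0 <= L -> lip_test L g ->
  `|fine (\int[P]_x (g x)%:E) - g 0| <= L * (beta - 1)^-1.
Proof.
move=> b12 PI L0 gt; have [b1 b0] := base_gt1_gt0 b12; have [g01 lg] := gt.
have mg := lip_test_measurable gt.
set M := (beta - 1)^-1.
have M0 : 0 <= M by rewrite invr_ge0; lra.
have LM0 : 0 <= L * M by rewrite mulr_ge0.
have g0 x : 0 <= g x by have /andP[] := g01 x.
have aeI (Q : R -> Prop) : (forall x, I_ beta x -> Q x) ->
    {ae P, forall x, [set: R] x -> Q x}.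
  move=> IQ; exists (~` I_ beta); split => //.
  - by apply: measurableC; exact: measurable_I.
  - by move=> x /= nQ Ix; apply: nQ => _; exact: IQ.
have gI x : I_ beta x -> `|x - 0| <= M.
  by rewrite /I_/= in_itv/= subr0 => /andP[x0 xM]; rewrite ger0_norm.
have cstE c : (\int[P]_x (cst c%:E) x = c%:E)%E.
  exact: integral_cst_probability.
have up : (\int[P]_x (g x)%:E <= (g 0 + L * M)%:E)%E.
  rewrite -cstE; apply: ae_ge0_le_integral => //.
  - by move=> x _; rewrite lee_fin.
  - by move=> x _; rewrite lee_fin addr_ge0.
  - apply: aeI => x Ix; rewrite lee_fin (le_trans (lg x 0))// lerD2l.
    by rewrite ler_wpM2l// gI.
have lo : ((g 0)%:E <= \int[P]_x (g x)%:E + (L * M)%:E)%E.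
  rewrite -(cstE (g 0)) -[X in (_ + X)%E]cstE -ge0_integralD//; last first.
    by move=> x _; rewrite lee_fin.
  apply: ae_ge0_le_integral => //.
  - by move=> x _; rewrite lee_fin.
  - by move=> x _; rewrite -EFinD lee_fin addr_ge0.
  - exact: emeasurable_funD.
  - apply: aeI => x Ix; rewrite -EFinD lee_fin (le_trans (lg 0 x))// lerD2l.
    by rewrite ler_wpM2l// distrC gI.
have fi := integral_lip_test_fin P gt.
move: up lo; rewrite -(fineK fi) -EFinD !lee_fin => up lo.
by rewrite ler_norml; apply/andP; split; lra.
Qed.

(** Self-similarity trades g for its compositions with the contractions, whose
    Lipschitz constant is smaller by a factor beta. *)
Lemma self_similar_lip_test_dist {R : realType} (beta : R)
    (P Q : probability (measurableTypeR R) R) n (L : R) (g : R -> R) :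
  1 < beta < 2 ->
  P (~` I_ beta) = 0%E -> self_similar beta P ->
  Q (~` I_ beta) = 0%E -> self_similar beta Q ->
  0 <= L -> lip_test L g ->
  `|fine (\int[P]_x (g x)%:E) - fine (\int[Q]_x (g x)%:E)| <=
    2 * L * (beta - 1)^-1 * beta ^- n.
Proof.
move=> b12 PI ssP QI ssQ; have [b1 b0] := base_gt1_gt0 b12.
elim: n L g => [|n IH] L g L0 gt.
  rewrite expr0 invr1 mulr1.
  have := integral_lip_test_near0 b12 PI L0 gt.
  have := integral_lip_test_near0 b12 QI L0 gt.
  rewrite !ler_norml => /andP[? ?] /andP[? ?]; apply/andP; split; lra.
have gbt b := lip_test_contract b b0 gt.
have E P' : self_similar beta P' -> fine (\int[P']_x (g x)%:E) = 2^-1 *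
    (fine (\int[P']_x ((g \o contract beta false) x)%:E) +
     fine (\int[P']_x ((g \o contract beta true) x)%:E)).
  move=> ssP'; rewrite (integral_lip_test_self_similar ssP' gt).
  rewrite -(fineK (integral_lip_test_fin P' (gbt false))).
  by rewrite -(fineK (integral_lip_test_fin P' (gbt true))) -EFinD -EFinM.
have Lb0 : 0 <= L / beta by rewrite divr_ge0// ltW.
have := IH _ _ Lb0 (gbt false); have := IH _ _ Lb0 (gbt true).
rewrite (E _ ssP) (E _ ssQ).
rewrite (_ : 2 * (L / beta) * _ * _ = 2 * L * (beta - 1)^-1 * beta ^- n.+1); last first.
  by rewrite exprS invfM; ring.
rewrite !ler_norml => /andP[? ?] /andP[? ?]; apply/andP; split; lra.
Qed.

Lemma self_similar_unique {R : realType} (beta : R)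
    (P Q : probability (measurableTypeR R) R) :
  1 < beta < 2 ->
  P (~` I_ beta) = 0%E -> self_similar beta P ->
  Q (~` I_ beta) = 0%E -> self_similar beta Q ->
  forall A, measurable A -> P A = Q A.
Proof.
move=> b12 PI ssP QI ssQ; have [b1 b0] := base_gt1_gt0 b12.
apply: eq_measure_lip_test.
  rewrite [X in (X < _)%E](_ : _ = 1%E) ?ltry//; exact: probability_setT.
move=> L g L0 gt.
rewrite -(fineK (integral_lip_test_fin P gt)) -(fineK (integral_lip_test_fin Q gt)).
congr EFin; apply/eqP; rewrite -subr_eq0 -normr_le0.
have h : geometric (2 * L * (beta - 1)^-1) (beta^-1) @ \oo --> 0.
  by apply: cvg_geometric; rewrite gtr0_norm ?invf_lt1 ?invr_gt0//; lra.
rewrite -(cvg_lim _ h)//; apply: limr_ge; first by apply/cvg_ex; eexists; exact: h.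
apply: nearW => n; rewrite /= exprVn.
exact: self_similar_lip_test_dist.
Qed.

(** * The Bernoulli convolution is self-similar and carried by the interval *)

Lemma word_point_I {R : realType} (beta : R) n (w : n.-tuple bool) :
  1 < beta -> I_ beta (word_point beta w).
Proof.
move=> b1; rewrite /I_/= in_itv/= /word_point.
under eq_bigr do rewrite (tnth_nth false).
exact: (digit_sum_I (nth false w)).
Qed.

Lemma nu_approx_I {R : realType} (beta : R) n : 1 < beta ->
  nu_approx n beta (~` I_ beta) = 0%E.
Proof.
move=> b1; rewrite /nu_approx big1 ?mule0// => w _.
by rewrite diracE memNset// => /(_ (word_point_I w b1)).
Qed.

Lemma word_point_cons {R : realType} (beta : R) n b (w : n.-tuple bool) :
  word_point beta [tuple of b :: w] = contract beta b (word_point beta w).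
Proof.
rewrite /word_point big_ord_recl/= expr1 /contract mulrDl addrC; congr (_ + _).
rewrite mulr_suml; apply: eq_bigr => i _.
by rewrite tnthS exprSr invfM mulrA.
Qed.

Lemma big_bool_tupleS {R : Type} {idx : R} {op : Monoid.com_law idx} n
    (F : n.+1.-tuple bool -> R) :
  \big[op/idx]_w F w =
  op (\big[op/idx]_(w : n.-tuple bool) F [tuple of false :: w])
     (\big[op/idx]_(w : n.-tuple bool) F [tuple of true :: w]).
Proof.
rewrite (reindex (fun p : bool * n.-tuple bool => [tuple of p.1 :: p.2])) /=.
  pose Fb (b : bool) (w : n.-tuple bool) := F [tuple of b :: w].
  by rewrite -(pair_bigA _ Fb)/= big_bool/= Monoid.mulmC.
exists (fun w => (thead w, [tuple of behead w])) => [[b w] _|w _] /=.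
  by congr pair; apply/val_inj.
by rewrite [RHS]tuple_eta.
Qed.

(** Prefixing a digit b to a word applies the contraction S_b to its point. *)
Lemma nu_approxS {R : realType} (beta : R) n (A : set (measurableTypeR R)) :
  nu_approx n.+1 beta A = branch_avg beta (nu_approx n beta) A.
Proof.
have sumS b : (\sum_(w : n.-tuple bool)
    \d_(word_point beta [tuple of b :: w]) A =
  \sum_(w : n.-tuple bool) \d_(word_point beta w) (contract beta b @^-1` A))%E.
  by apply: eq_bigr => w _; rewrite word_point_cons.
rewrite branch_avgE /= /nu_approx big_bool_tupleS !sumS exprS invfM EFinM -muleA.
congr (_ * _)%E; rewrite ge0_muleDr//.
- by apply: sume_ge0 => w _; rewrite diracE lee_fin.
- by apply: sume_ge0 => w _; rewrite diracE lee_fin.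
Qed.

(** The limit of nu_(n+1) = branch_avg nu_n, tested on Lipschitz functions, whose
    compositions with the contractions are again test functions. *)
Lemma bernoulli_self_similar {R : realType} (beta : R)
    (nu : probability (measurableTypeR R) R) :
  0 < beta -> is_bernoulli_convolution beta nu -> self_similar beta nu.
Proof.
move=> b0 nuP; apply: eq_measure_lip_test.
  rewrite [X in (X < _)%E](_ : _ = 1%E) ?ltry//; exact: probability_setT.
move=> L g L0 gt.
have lim L' g' : lip_test L' g' ->
    (\int[nu_approx n beta]_x (g' x)%:E)%E @[n --> \oo] --> (\int[nu]_x (g' x)%:E)%E.
  by move=> gt'; apply: nuP;
    [exact: lip_test_continuous gt'|exact: lip_test_bounded gt'].
have gbt b := lip_test_contract b b0 gt.
have avg (P : probability (measurableTypeR R) R) :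
    (\int[branch_avg beta P]_x (g x)%:E =
     (2^-1)%:E * (\int[P]_x ((g \o contract beta false) x)%:E +
                  \int[P]_x ((g \o contract beta true) x)%:E))%E.
  rewrite integral_branch_avg//; first exact: lip_test_measurable gt.
  by move=> x; rewrite lee_fin; have [/(_ x)/andP[]] := gt.
have h1 : (\int[nu_approx n.+1 beta]_x (g x)%:E)%E @[n --> \oo] -->
    (\int[nu]_x (g x)%:E)%E.
  by rewrite (cvg_shiftS (fun n => \int[nu_approx n beta]_x (g x)%:E)%E); exact: lim gt.
have h2 : (\int[nu_approx n.+1 beta]_x (g x)%:E)%E @[n --> \oo] -->
    (\int[branch_avg beta nu]_x (g x)%:E)%E.
  rewrite avg.
  under eq_fun => n.
    rewrite (eq_measure_integral (branch_avg beta (nu_approx n beta))); last first.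
      by move=> A _ _; exact: nu_approxS.
    rewrite avg; over.
  apply: cvgeZl => //; apply: cvgeD.
  - by apply: fin_num_adde_defr; exact: integral_lip_test_fin (gbt false).
  - exact: lim (gbt false).
  - exact: lim (gbt true).
exact: cvg_unique h1 h2.
Qed.

(** Tested against the truncated distance to I, which vanishes exactly on I: the
    approximating measures give 0, hence so does their weak-star limit. *)
Lemma bernoulli_I {R : realType} (beta : R)
    (nu : probability (measurableTypeR R) R) :
  1 < beta < 2 -> is_bernoulli_convolution beta nu -> nu (~` I_ beta) = 0%E.
Proof.
move=> b12 nuP; have [b1 b0] := base_gt1_gt0 b12.
set M := (beta - 1)^-1.
pose s x := Num.max 0 (Num.max (- x) (x - M)).
pose g x := Num.min 1 (s x).
have gt : lip_test 1 g.
  apply: lip_test_min => // [x|x y]; first by rewrite le_max lexx.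
  rewrite mul1r; have := ler_norm (x - y); have := ler_norm (y - x).
  rewrite distrC /s => ? ?; have := normr_ge0 (x - y) => ?.
  rewrite !ge_max; apply/and3P; split.
  - by rewrite ler_wpDr// le_max lexx.
  - rewrite -lerBlDr !le_max; apply/orP; right; apply/orP; left; lra.
  - rewrite -lerBlDr !le_max; apply/orP; right; apply/orP; right; lra.
have mg := lip_test_measurable gt.
have g0 x : 0 <= g x by have [/(_ x)/andP[]] := gt.
have gI x : I_ beta x -> g x = 0.
  rewrite /I_/= in_itv/= => /andP[x0 xM]; rewrite /g /s.
  rewrite (_ : Num.max 0 _ = 0); first by apply/min_idPr.
  by apply/max_idPl; rewrite ge_max; apply/andP; split; rewrite -/M in xM; lra.
have gC x : ~ I_ beta x -> 0 < g x.
  move=> nI; rewrite lt_min ltr01/= !lt_max; apply/orP; right.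
  rewrite oppr_gt0 subr_gt0 ltNge [(M < _)]ltNge -negb_and; apply/negP => h.
  by apply: nI; rewrite /I_/= in_itv.
have mC : measurable (~` I_ beta : set (measurableTypeR R)).
  by apply: measurableC; exact: measurable_I.
have z n : (\int[nu_approx n beta]_x (g x)%:E = 0)%E.
  rewrite (@ge0_negligible_integral _ _ _ (nu_approx n beta) setT (~` I_ beta))//.
  - by rewrite integral0_eq// => x [_ /= /contrapT/gI ->].
  - by move=> x _; rewrite lee_fin.
  - exact: nu_approx_I.
have : (\int[nu]_x (g x)%:E = 0)%E.
  have := nuP g (lip_test_continuous gt) (lip_test_bounded gt).
  under eq_fun do rewrite z.
  by move=> h; have := cvg_unique _ h (cvg_cst 0%E) => ->.
move=> gz; have : (\int[nu]_x `|(g x)%:E| = 0)%E.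
  by under eq_integral do rewrite gee0_abs ?lee_fin//.
move/(ae_eq_integral_abs nu measurableT mg) => [N [mN N0 sN]].
apply/eqP; rewrite eq_le measure_ge0 andbT -N0 le_measure ?inE//.
move=> x nI; apply: sN => /= h; have := h I => -[gx].
by have := gC _ nI; rewrite gx ltxx.
Qed.

(** * The normalised lower limit as a density *)

(** The hypotheses on d are arguments of the definition, so that the canonical
    probability structure on [density_probability] can retrieve them. *)
Definition density_probability {R : realType} (d : R -> \bar R)
    (md : measurable_fun setT d) (d0 : forall x, (0 <= d x)%E)
    (d1 : (\int[lebesgue_measure]_x d x = 1)%E)
    (A : set (measurableTypeR R)) : \bar R :=
  (\int[lebesgue_measure]_(x in A) d x)%E.

Section density_probability.
Context {R : realType} (d : R -> \bar R) (md : measurable_fun setT d)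
  (d0 : forall x, (0 <= d x)%E) (d1 : (\int[lebesgue_measure]_x d x = 1)%E).

Local Notation P := (density_probability md d0 d1).

Let P0 : P set0 = 0%E.
Proof. exact: integral_set0. Qed.

Let P_ge0 A : (0 <= P A)%E.
Proof. exact: integral_ge0. Qed.

Let P_sigma_additive : semi_sigma_additive P.
Proof.
move=> F mF tF mUF; rewrite /density_probability; apply: cvg_toP.
  apply: ereal_nondecreasing_is_cvgn => m n mn.
  by apply: lee_sum_nneg_natr => // k _ _; exact: integral_ge0.
rewrite ge0_integral_bigcup//=.
by apply: measurable_funTS.
Qed.

HB.instance Definition _ := isMeasure.Build _ _ _ P P0 P_ge0 P_sigma_additive.

Let P1 : P setT = 1%E. Proof. exact: d1. Qed.

HB.instance Definition _ := Measure_isProbability.Build _ _ _ P P1.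

End density_probability.

(** The normalised liminf is the density of a self-similar probability on I, so
    uniqueness identifies it with the Bernoulli convolution. *)
Lemma bernoulli_f_inf {R : realType} (beta : R)
    (nu : probability (measurableTypeR R) R) :
  1 < beta < 2 -> is_bernoulli_convolution beta nu ->
  (0 < int_f_inf beta < +oo)%E ->
  forall A, measurable A ->
    nu A = (\int[lebesgue_measure]_(x in A)
              (((fine (int_f_inf beta))^-1)%:E * f_inf beta x))%E.
Proof.
move=> b12 nuP /andP[J0 Joo]; have [b1 b0] := base_gt1_gt0 b12.
set r := (fine (int_f_inf beta))^-1.
have mf := measurable_f_inf b12; have f0 := f_inf_ge0 b12.
have Jr : 0 < fine (int_f_inf beta) by rewrite fine_gt0// J0.
have r0 : 0 < r by rewrite invr_gt0.
have md : measurable_fun setT (fun x => r%:E * f_inf beta x)%E.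
  exact: measurable_funeM.
have d0 x : (0 <= r%:E * f_inf beta x)%E by rewrite mule_ge0// lee_fin ltW.
have intE (A : set (measurableTypeR R)) : measurable A ->
    (\int[lebesgue_measure]_(x in A) (r%:E * f_inf beta x) =
     r%:E * \int[lebesgue_measure]_(x in A) f_inf beta x)%E.
  move=> mA; rewrite ge0_integralZl//; first exact: measurable_funTS.
  by rewrite lee_fin ltW.
have d1 : (\int[lebesgue_measure]_x (r%:E * f_inf beta x) = 1)%E.
  rewrite intE// -int_f_infE// -(fineK (_ : int_f_inf beta \is a fin_num)).
    by rewrite -EFinM mulVf// gt_eqF.
  by rewrite ge0_fin_numE// ltW.
pose P : probability (measurableTypeR R) R := density_probability md d0 d1.
suff PA A : measurable A -> nu A = P A by [].
have mcA b B : measurable B -> measurable (contract beta b @^-1` B : set (measurableTypeR R)).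
  by move=> mB; rewrite -[_ @^-1` _]setTI; exact: measurable_contract.
move: A; apply: (self_similar_unique b12).
- exact: bernoulli_I.
- exact: bernoulli_self_similar.
- rewrite /P/= /density_probability integral0_eq// => x xI.
  by rewrite f_inf_eq0_out// mule0.
- move=> A mA; rewrite branch_avgE /P/= /density_probability !intE//; try exact: mcA.
  rewrite integral_f_inf_branch// muleCA; congr (_ * _)%E.
  by rewrite ge0_muleDr// integral_ge0.
Qed.

(** * Lower bound from a bounded density *)

(** Both sides evolve by the same rule under the two contractions, so only n = 0,
    where the bound h <= C and the support I enter, has content. *)
Lemma bernoulli_le_integral_f {R : realType} (beta C : R) (h : R -> R)
    (nu : probability (measurableTypeR R) R) n (A : set (measurableTypeR R)) :
  1 < beta < 2 -> is_bernoulli_convolution beta nu -> is_density nu h ->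
  0 < C -> (forall x, h x <= C) -> measurable A ->
  (nu A <= (C / (beta - 1))%:E *
           \int[lebesgue_measure]_(x in A) (f_ n beta x)%:E)%E.
Proof.
move=> b12 nuP [mh h0 nuh] C0 hC; have [b1 b0] := base_gt1_gt0 b12.
have K0 : 0 < C / (beta - 1) by rewrite divr_gt0//; lra.
have f0 m x : (0 <= (f_ m beta x)%:E)%E by rewrite lee_fin f_ge0.
elim: n A => [|n IH] A mA.
- have mI := measurable_I beta.
  have -> : nu A = nu (A `&` I_ beta).
    apply/eqP; rewrite eq_le; apply/andP; split; last first.
      by apply: le_measure; rewrite ?inE//; exact: measurableI.
    rewrite -[leLHS](_ : nu ((A `&` I_ beta) `|` (A `&` ~` I_ beta)) = _); last first.
      by rewrite -setIUr setUv setIT.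
    apply: le_trans (measureU2 _ _ _) _; [exact: measurableI| |].
      by apply: measurableI => //; exact: measurableC.
    rewrite -[leRHS]adde0 leeD2l// -(bernoulli_I b12 nuP).
    by apply: le_measure; rewrite ?inE//;
      [apply: measurableI => //|]; exact: measurableC.
  rewrite nuh; last exact: measurableI.
  under [in leRHS]eq_integral do rewrite f_0// EFinM.
  rewrite [in leRHS]ge0_integralZl//; last 2 first.
  + by apply: measurable_funTS; apply/measurable_EFinP/measurable_indic.
  + by rewrite lee_fin; lra.
  rewrite integral_indic// muleA -EFinM divfK; last by rewrite gt_eqF//; lra.
  rewrite setIC -integral_cst; last exact: measurableI.
  apply: ge0_le_integral => //.
  + exact: measurableI.
  + by move=> x _; rewrite lee_fin.
  + by apply/measurable_EFinP; exact: measurable_funTS.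
  + by move=> x _; rewrite lee_fin.
- rewrite (bernoulli_self_similar b0 nuP mA) branch_avgE.
  have mcA b : measurable (contract beta b @^-1` A : set (measurableTypeR R)).
    by rewrite -[_ @^-1` _]setTI; exact: measurable_contract.
  under eq_integral do rewrite f_transfer//.
  rewrite integral_transfer//; last exact: measurable_f.
  rewrite muleCA lee_pmul2l//.
  by rewrite ge0_muleDr ?integral_ge0//; apply: leeD; exact: IH.
Qed.

(** The excess h - f is positive on the set where h > f, but has integral at most
    0 there, so that set is null. *)
Lemma ae_le_of_integral_le {R : realType} (h f : R -> R) :
  measurable_fun setT h -> measurable_fun setT f ->
  (forall x, 0 <= f x) ->
  (\int[lebesgue_measure]_x (f x)%:E < +oo)%E ->
  (forall A : set (measurableTypeR R), measurable A ->
     \int[lebesgue_measure]_(x in A) (h x)%:E <=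
     \int[lebesgue_measure]_(x in A) (f x)%:E)%E ->
  {ae lebesgue_measure, forall x : R, h x <= f x}.
Proof.
move=> mh mf f0 foo hf.
pose q x := h x - f x.
pose D : set (measurableTypeR R) := [set x | 0 < q x].
have mq : measurable_fun setT q by exact: measurable_funB.
have mD : measurable D.
  have -> : D = setT `&` q @^-1` `]0, +oo[%classic.
    by rewrite setTI; apply/seteqP; split => x; rewrite /D/= in_itv/= andbT.
  by apply: mq => //; exact: measurable_itv.
have q0 x : D x -> (0 <= (q x)%:E)%E by rewrite /D/= lee_fin => /ltW.
have mqD : measurable_fun D (fun x => (q x)%:E).
  by apply/measurable_EFinP; exact: measurable_funTS.
have mfD : measurable_fun D (fun x => (f x)%:E).
  by apply/measurable_EFinP; exact: measurable_funTS.
have fD : (\int[lebesgue_measure]_(x in D) (f x)%:E)%E \is a fin_num.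
  rewrite ge0_fin_numE; last by apply: integral_ge0 => x _; rewrite lee_fin.
  apply: le_lt_trans foo; apply: ge0_subset_integral => //.
  - by apply/measurable_EFinP.
  - by move=> x _; rewrite lee_fin.
have : (\int[lebesgue_measure]_(x in D) (h x)%:E =
        \int[lebesgue_measure]_(x in D) (f x)%:E +
        \int[lebesgue_measure]_(x in D) (q x)%:E)%E.
  rewrite -ge0_integralD//; last by move=> x _; rewrite lee_fin.
  by apply: eq_integral => x _; rewrite -EFinD /q addrC subrK.
have := hf _ mD => /[swap] ->; rewrite -[leRHS]adde0 leeD2lE// => qle.
have : (\int[lebesgue_measure]_(x in D) `|(q x)%:E| = 0)%E.
  apply/eqP; rewrite eq_le integral_ge0 ?andbT//.
  apply: le_trans qle; rewrite le_eqVlt; apply/orP; left; apply/eqP.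
  by apply: eq_integral => x /[!inE] Dx; rewrite gee0_abs// q0.
move/(ae_eq_integral_abs lebesgue_measure mD mqD) => [N [mN N0 sN]].
exists N; split => // x /= nle; apply: sN => /= hD.
have Dx : D x by rewrite /D/= /q subr_gt0 ltNge; exact/negP.
by have [qx] := hD Dx; move: Dx; rewrite /D/= qx ltxx.
Qed.

(** Countably many almost everywhere inequalities (beta - 1) / C h <= f_n hold
    simultaneously almost everywhere, hence pass to the liminf. *)
Lemma int_f_inf_ge_of_bounded_density {R : realType} (beta C : R) (h : R -> R)
    (nu : probability (measurableTypeR R) R) :
  1 < beta < 2 -> is_bernoulli_convolution beta nu -> is_density nu h ->
  0 < C -> (forall x, h x <= C) ->
  (((beta - 1) / C)%:E <= int_f_inf beta)%E.
Proof.
move=> b12 nuP hP C0 hC; have [b1 b0] := base_gt1_gt0 b12.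
have [mh h0 nuh] := hP.
set k := (beta - 1) / C.
have k0 : 0 < k by rewrite divr_gt0//; lra.
have mkh : measurable_fun setT (fun x => k * h x) by exact: measurable_funM.
have mf n : measurable_fun setT (f_ n beta).
  by apply/measurable_EFinP; exact: measurable_f.
have ae_n n : {ae lebesgue_measure, forall x : R, k * h x <= f_ n beta x}.
  apply: ae_le_of_integral_le => //.
  - by move=> x; exact: f_ge0.
  - by rewrite integral_f// ltry.
  - move=> A mA; under eq_integral do rewrite EFinM.
    rewrite ge0_integralZl//; last 3 first.
    + by apply/measurable_EFinP; exact: measurable_funTS.
    + by move=> x _; rewrite lee_fin.
    + by rewrite lee_fin ltW.
    rewrite -nuh//; have := bernoulli_le_integral_f n b12 nuP hP C0 hC mA.
    rewrite -(@lee_pmul2l _ k%:E)//.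
    rewrite muleA -EFinM (_ : k * _ = 1) ?mul1e//.
    by rewrite /k; field; lra.
have ae_all := ae_foralln ae_n.
have <- : (\int[lebesgue_measure]_x (k * h x)%:E = k%:E)%E.
  under eq_integral do rewrite EFinM.
  rewrite ge0_integralZl//; last 3 first.
  - by apply/measurable_EFinP.
  - by move=> x _; rewrite lee_fin.
  - by rewrite lee_fin ltW.
  by rewrite -nuh// (_ : nu setT = 1%E) ?mule1//; exact: probability_setT.
rewrite int_f_infE//; apply: ae_ge0_le_integral => //.
- by move=> x _; rewrite lee_fin mulr_ge0// ltW.
- by apply/measurable_EFinP.
- by move=> x _; exact: f_inf_ge0.
- exact: measurable_f_inf.
- apply: filterS ae_all => x le_x _.
  rewrite /f_inf limn_einf_lim; apply: lime_ge; first exact: is_cvg_einfs.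
  apply: nearW => n; apply: le_ereal_inf_tmp => _ [m _ <-].
  by rewrite lee_fin.
Qed.

(** * The density theorem and its converse *)

Unset Implicit Arguments.

Theorem theorem2p2 (R : realType) (beta : R)
    (nu : probability (measurableTypeR R) R) :
  1 < beta < 2 ->
  is_bernoulli_convolution beta nu ->
  ((0 < int_f_inf beta < +oo)%E ->
     nu `<< lebesgue_measure /\
     exists h : R -> R, is_density nu h /\
       {ae lebesgue_measure, forall x : R, I_ beta x ->
          (h x)%:E = (f_inf beta x / int_f_inf beta)%E}) /\
  (nu `<< lebesgue_measure ->
     (exists h : R -> R, is_density nu h /\ bounded_fun h) ->
     (0 < int_f_inf beta < +oo)%E).
Proof.
move=> b12 nuP; have [b1 b0] := base_gt1_gt0 b12; split.
- move=> J; have nuE := bernoulli_f_inf b12 nuP J.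
  have mf := measurable_f_inf b12; have f0 := f_inf_ge0 b12.
  have /andP[J0 Joo] := J.
  have Jfin : int_f_inf beta \is a fin_num by rewrite ge0_fin_numE// ltW.
  have Jr : 0 < fine (int_f_inf beta) by rewrite fine_gt0// J0.
  pose r := (fine (int_f_inf beta))^-1; rewrite -/r in nuE.
  have r0 : 0 < r by rewrite invr_gt0.
  have md : measurable_fun setT (fun x => r%:E * f_inf beta x)%E.
    exact: measurable_funeM.
  pose h x : R := r * fine (f_inf beta x).
  have h0 x : 0 <= h x by rewrite mulr_ge0 ?fine_ge0// ltW.
  have mh : measurable_fun setT h.
    by apply: measurable_funM => //; exact: measurableT_comp.
  have fin : {ae lebesgue_measure, forall x : R, f_inf beta x \is a fin_num}.
    have : lebesgue_measure.-integrable setT (f_inf beta).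
      apply/integrableP; split => //.
      by under eq_integral do rewrite gee0_abs//; rewrite -int_f_infE.
    move/(integrable_ae measurableT); apply: filterS => x; exact.
  split; [|exists h; split; [split => //|]].
  + apply/null_content_dominatesP => A mA A0.
    by rewrite nuE// null_set_integral//; exact: measurable_funTS.
  + move=> A mA; rewrite nuE//; apply: ge0_ae_eq_integral => //.
    * exact: measurable_funTS.
    * by apply/measurable_EFinP; exact: measurable_funTS.
    * by move=> x _; rewrite mule_ge0// lee_fin ltW.
    * by move=> x _; rewrite lee_fin.
    * have [N [mN N0 sN]] := fin; exists N; split => // x /= nx; apply: sN => /= fx.
      by apply: nx => _; rewrite /h EFinM fineK.
  + have [N [mN N0 sN]] := fin; exists N; split => // x /= nx; apply: sN => /= fx.
    apply: nx => _.
    by rewrite /h mulrC EFinM fineK// -(fineK Jfin) inver gt_eqF.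
- move=> _ [h [hP [M0 [_ hM]]]].
  (* a bounded function is only bounded by the numbers strictly above M0 *)
  pose C := `|M0| + 1.
  have hC x : h x <= C.
    apply: le_trans (ler_norm _) _; apply: hM => //.
    by rewrite /C; have := ler_norm M0; lra.
  have C0 : 0 < C by rewrite ltr_wpDl.
  apply/andP; split.
  + apply: lt_le_trans (int_f_inf_ge_of_bounded_density b12 nuP hP C0 hC).
    by rewrite lte_fin divr_gt0//; lra.
  + by rewrite (le_lt_trans (int_f_inf_le1 b12))// ltry.
Qed.
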